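(* Let $G$ be a group with an involution $\alpha$, let $\mathcal{H}$ be a Hilbert space and let $\varphi:G\to L(\mathcal{H})$ be an $\alpha$-completely positive map. (1) There are a Krein space $(\mathcal{H}_\varphi,\mathcal{J}_\varphi)$, a $\mathcal{J}_\varphi$-unitary representation $\pi_\varphi$ of $G$ on $(\mathcal{H}_\varphi,\mathcal{J}_\varphi)$ and a bounded linear operator $V_\varphi:\mathcal{H}\to\mathcal{H}_\varphi$ such that (a) $\varphi(g)=V_\varphi^{*}\pi_\varphi(g)V_\varphi$ for all $g\in G$; (b) $[\pi_\varphi(G)V_\varphi\mathcal{H}]=\mathcal{H}_\varphi$; (c) $\mathcal{J}_\varphi\pi_\varphi(g)V_\varphi=\pi_\varphi(\alpha(g))V_\varphi$ for all $g\in G$. (2) With $(\pi_\varphi,(\mathcal{H}_\varphi,\mathcal{J}_\varphi),V_\varphi)$ as in (1): if $\pi$ is a $\mathcal{J}$-unitary representation of $G$ on a Krein space $(\mathcal{K},\mathcal{J})$ and $V:\mathcal{H}\to\mathcal{K}$ is a bounded linear operator such that (a) $\varphi(g)=V^{*}\pi(g)V$ for all $g\in G$; (b) $[\pi(G)V\mathcal{H}]=\mathcal{K}$; (c) $\mathcal{J}\pi(g)V=\pi(\alpha(g))V$ for all $g\in G$, then there is a unitary operator $U:\mathcal{H}_\varphi\to\mathcal{K}$ such that $U\mathcal{J}_\varphi=\mathcal{J}U$, $UV_\varphi=V$, and $U\pi_\varphi(g)=\pi(g)U$ for all $g\in G$.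
   Context: An involution of a group $G$ (with identity $e$) is a map $\alpha:G\to G$ (assumed continuous if $G$ is a topological group) with $\alpha^{2}=\mathrm{id}_G$, $\alpha(e)=e$ and $\alpha(g^{-1})=\alpha(g)^{-1}$ for all $g\in G$; it is not required to be a homomorphism. $L(\mathcal{H})$ denotes the bounded linear operators on a Hilbert space $\mathcal{H}$. An $n\times n$ matrix with entries in $L(\mathcal{H})$ is regarded as an operator on $\mathcal{H}^n$; positivity and the order $\leq$ between such matrices refer to this. A map $\varphi:G\to L(\mathcal{H})$ is $\alpha$-completely positive if: (1) $\varphi(\alpha(g_1)\alpha(g_2))=\varphi(\alpha(g_1g_2))=\varphi(g_1g_2)$ for all $g_1,g_2\in G$; (2) for all $n$ and $g_1,\dots,g_n\in G$, the matrix $[\varphi(\alpha(g_i)^{-1}g_j)]_{i,j=1}^n$ is positive; (3) there is $K>0$ such that $[\varphi(g_i)^{*}\varphi(g_j)]_{i,j=1}^n\leq K[\varphi(\alpha(g_i)^{-1}g_j)]_{i,j=1}^n$ for all $n$ and $g_1,\dots,g_n\in G$; (4) for every $g\in G$ there is $M(g)>0$ such that $[\varphi(\alpha(gg_i)^{-1}gg_j)]_{i,j=1}^n\leq M(g)[\varphi(\alpha(g_i)^{-1}g_j)]_{i,j=1}^n$ for all $n$ and $g_1,\dots,g_n\in G$. A Krein space is a pair $(\mathcal{K},\mathcal{J})$ of a Hilbert space $\mathcal{K}$ and a bounded linear operator $\mathcal{J}$ on $\mathcal{K}$ with $\mathcal{J}=\mathcal{J}^{*}=\mathcal{J}^{-1}$.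 A $\mathcal{J}$-unitary representation of $G$ on $(\mathcal{K},\mathcal{J})$ is a multiplicative map $\pi:G\to L(\mathcal{K})$ with $\pi(e)=\mathrm{id}_{\mathcal{K}}$ and $\pi(g^{-1})=\mathcal{J}\pi(g)^{*}\mathcal{J}$ for all $g\in G$. $[\pi(G)V\mathcal{H}]$ denotes the closed linear span of $\{\pi(g)V\xi: g\in G,\ \xi\in\mathcal{H}\}$. *)

(* Defs.v *)
From HB Require Import structures.
From mathcomp Require Export all_boot all_order all_algebra.
From mathcomp Require Export complex.
From mathcomp Require Export boolp classical_sets functions reals.
From mathcomp Require Export topology normedtype.

Set Implicit Arguments.
Unset Strict Implicit.
Unset Printing Implicit Defensive.

Import Order.TTheory GRing.Theory Num.Theory.
Import numFieldNormedType.Exports.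

Local Open Scope classical_set_scope.
Local Open Scope ring_scope.
Local Open Scope complex_scope.

(* The inner product of [{dot _ for _}] is linear in its first argument and
   conjugate-linear in its second one. *)
HB.mixin Record CompleteNormedModule_isHilbert (R : realType) V
    & CompleteNormedModule R[i] V := {
  hdot : {dot V for @Num.conj R[i]} ;
  hdot_norm : forall x : V, hdot x x = `|x| ^+ 2
}.

#[short(type="hilbertType")]
HB.structure Definition Hilbert (R : realType) :=
  {V of CompleteNormedModule R[i] V & CompleteNormedModule_isHilbert R V}.

Record bounded_op (R : realType) (H K : hilbertType R) := BoundedOp {
  bounded_op_fun :> {linear H -> K} ;
  bounded_op_bounded : bounded_near bounded_op_fun (nbhs (0 : H))
}.

HB.instance Definition _ (R : realType) (H K : hilbertType R) :=
  gen_eqMixin (bounded_op H K).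
HB.instance Definition _ (R : realType) (H K : hilbertType R) :=
  gen_choiceMixin (bounded_op H K).

Section operators.
Variable R : realType.
Implicit Types H K : hilbertType R.

Lemma bounded_null H K : bounded_near (\0 : H -> K) (nbhs (0 : H)).
Proof. by apply/ex_bound; exists 0; apply: nearW => x /=; rewrite normr0. Qed.

Definition bounded_op0 H K : bounded_op H K := BoundedOp (@bounded_null H K).

(* By the Riesz representation theorem there is exactly one such [B], so that
   the default value is never used. *)
Definition adjoint H K (A : bounded_op H K) : bounded_op K H :=
  xget (bounded_op0 K H)
    [set B : bounded_op K H | forall x y, hdot (A x) y = hdot x (B y)].

Definition unitary H K (U : bounded_op H K) : Prop :=
  adjoint U \o U =1 id /\ U \o adjoint U =1 id.

(* [J] is its own inverse and its own adjoint: [(K, J)] is a Krein space. *)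
Definition fundamental_symmetry K (J : bounded_op K K) : Prop :=
  adjoint J = J /\ J \o J =1 id.

Definition lin_span K (A : set K) : set K :=
  [set x | exists n (c : 'I_n -> R[i]) (v : 'I_n -> K),
    (forall i, A (v i)) /\ x = \sum_i c i *: v i].

Definition closed_lin_span K (A : set K) : set K := closure (lin_span A).

(* An operator matrix [A] acts on [H^n], whose elements are the families
   ['I_n -> H] with inner product [\sum_i hdot (x i) (y i)]. *)
Definition opmx_apply H n (A : 'M[H -> H]_n) (x : 'I_n -> H) : 'I_n -> H :=
  fun i => \sum_j A i j (x j).

(* Recall that [0 <= z] in [R[i]] means that [z] is real and nonnegative. *)
Definition opmx_pos H n (A : 'M[H -> H]_n) : Prop :=
  forall x : 'I_n -> H, 0 <= \sum_i hdot (opmx_apply A x i) (x i).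

Definition opmx_le H n (A B : 'M[H -> H]_n) : Prop := opmx_pos (B - A).

Definition opmx_scale H n (a : R) (A : 'M[H -> H]_n) : 'M[H -> H]_n :=
  map_mx (fun T : H -> H => a%:C *: T) A.

End operators.

Section groups.
Variables (R : realType) (G : groupType).
Implicit Types H K : hilbertType R.

Definition group_involution (alpha : G -> G) : Prop :=
  [/\ involutive alpha, alpha 1%g = 1%g
    & forall g, alpha g^-1%g = (alpha g)^-1%g].

Definition alpha_gram H (alpha : G -> G) (phi : G -> bounded_op H H)
    n (g : 'I_n -> G) : 'M[H -> H]_n :=
  \matrix_(i, j) (phi ((alpha (g i))^-1 * g j)%g : H -> H).

Definition alpha_completely_positive H (alpha : G -> G)
    (phi : G -> bounded_op H H) : Prop :=
  [/\ forall g1 g2, phi (alpha g1 * alpha g2)%g = phi (alpha (g1 * g2)%g) /\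
        phi (alpha (g1 * g2)%g) = phi (g1 * g2)%g,
      forall n (g : 'I_n -> G), opmx_pos (alpha_gram alpha phi g),
      exists K : R, 0 < K /\ forall n (g : 'I_n -> G),
        opmx_le (\matrix_(i, j) (adjoint (phi (g i)) \o phi (g j)))
                (opmx_scale K (alpha_gram alpha phi g))
    & forall g : G, exists M : R, 0 < M /\ forall n (h : 'I_n -> G),
        opmx_le (alpha_gram alpha phi (fun i => g * h i)%g)
                (opmx_scale M (alpha_gram alpha phi h))].

Definition J_unitary_rep K (J : bounded_op K K) (pi : G -> bounded_op K K) :
    Prop :=
  [/\ forall g h, pi (g * h)%g =1 pi g \o pi h,
      pi 1%g =1 id
    & forall g, pi g^-1%g =1 J \o adjoint (pi g) \o J].

Definition krein_dilation H (alpha : G -> G) (phi : G -> bounded_op H H)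
    K (J : bounded_op K K) (pi : G -> bounded_op K K) (V : bounded_op H K) :
    Prop :=
  [/\ fundamental_symmetry J,
      J_unitary_rep J pi,
      forall g, phi g =1 adjoint V \o pi g \o V,
      closed_lin_span [set x | exists g xi, x = pi g (V xi)] = setT
    & forall g, J \o pi g \o V =1 pi (alpha g) \o V].

End groups.

(* Main.v *)
From HB Require Import structures.
From mathcomp Require Import interval_inference ring.
Require Import Defs.

(** A dilation [(pi, J, V)] is determined, up to a unitary, by the inner
    products of the vectors [pi g (V xi)], because they span a dense subspace.
    The relation [pi(h)^* = J pi(h^-1) J], together with the rule
    [J pi(g) V = pi(alpha g) V], expresses these inner products through [phi]:
    the one of [pi g (V xi)] and [pi h (V eta)] is
<<
      k ((g, xi), (h, eta)) = < phi (alpha(h)^-1 g) xi, eta >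
>>
    ([krein_dilation_gram]). Uniqueness follows at once: two total families
    with the same Gram kernel correspond under a unitary ([gram_unitary]),
    which intertwines everything that permutes the family.

    For existence, complete positivity says that [k] is a positive definite
    kernel on [G * H]. Such a kernel is the Gram kernel of a total family [i]
    in some Hilbert space ([kernel_realization]), here the reproducing kernel
    Hilbert space of functions on [G * H]. The operators are then prescribed
    on the family: [V xi = i (1, xi)], [pi(g) i(h, xi) = i (g h, xi)] and
    [J i(g, xi) = i (alpha g, xi)]. By [bounded_extension] such a prescription
    extends to a bounded operator as soon as it is bounded for the form of
    [k]; for [pi(g)] this is the fourth condition in the definition of an
    alpha-completely positive map, and [J] preserves [k] because of the first
    one. The algebraic identities need only be checked on the family.

    Adjoints of arbitrary bounded operators, which occur in the definition of
    a dilation, come from the Riesz representation theorem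
    ([riesz_representation]). *)

Set Implicit Arguments.
Unset Strict Implicit.
Unset Printing Implicit Defensive.

Import Order.TTheory GRing.Theory Num.Theory.
Import numFieldNormedType.Exports.

Local Open Scope classical_set_scope.
Local Open Scope ring_scope.
Local Open Scope complex_scope.

(** * Complex scalars *)

Section scalars.
Variable R : realType.
Local Notation C := R[i].

(** The scalar form of the Cauchy-Schwarz inequality: it covers at once a
    degenerate form ([B = 0] forces [d = 0]), the inner product of a Hilbert
    space and the minimisation argument of the Riesz theorem. *)
Lemma discriminant_le (A B d : C) : 0 <= A -> 0 <= B ->
  (forall t : C, 0 <= A + t * d + (t * d)^*%R + t * t^*%R * B) ->
  `|d| ^+ 2 <= A * B.
Proof.
move=> A0 B0 h; have [->|d0] := eqVneq d 0.
  by rewrite normr0 expr0n mulr_ge0.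
have dd : 0 < `|d| ^+ 2 by rewrite exprn_gt0 // normr_gt0.
(* Only the values [t = - r d^*] with [r] nonnegative matter: along them the
   expression is a real quadratic polynomial in [r]. *)
have key (r : C) : 0 <= r -> 0 <= A - 2 * r * `|d| ^+ 2 + r ^+ 2 * `|d| ^+ 2 * B.
  move=> r0; have rR : r^*%R = r by apply/CrealP; exact: ger0_real.
  have := h (- r * d^*%R).
  rewrite !rmorphM /= !rmorphN /= conjCK rR normCK.
  by congr (0 <= _); ring.
have [D DE] : exists D : C, D = `|d| ^+ 2 by eexists.
rewrite -DE in dd key *.
have [B00|Bn0] := eqVneq B 0.
  have := key ((A + 1) / D) (divr_ge0 (addr_ge0 A0 ler01) (ltW dd)).
  rewrite [X in 0 <= X](_ : _ = - (A + 2)); last by rewrite B00; field; rewrite ?gt_eqF.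
  by rewrite oppr_ge0 lt_geF // ltr_wpDl.
have := key B^-1; rewrite invr_ge0 => /(_ B0).
rewrite [X in 0 <= X](_ : _ = (A * B - D) / B); last by field.
by rewrite pmulr_lge0 ?subr_ge0// invr_gt0 lt0r Bn0.
Qed.

(** Over the complex numbers positivity forces hermitian symmetry: the cross
    terms are real for [t = 1] and for [t = 'i], and this determines [a]
    from [b]. *)
Lemma hermitian_of_pos (A B a b : C) : 0 <= A -> 0 <= B ->
  (forall t : C, 0 <= A + t^*%R * a + t * b + t * t^*%R * B) -> a = b^*%R.
Proof.
move=> A0 B0 h.
have h1 t : (t^*%R * a + t * b)^*%R = t^*%R * a + t * b.
  apply/CrealP; have -> : t^*%R * a + t * b =
      (A + t^*%R * a + t * b + t * t^*%R * B) - (A + t * t^*%R * B) by ring.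
  rewrite rpredB// ?ger0_real//; apply: addr_ge0 => //; apply: mulr_ge0 => //.
  exact: mul_conjC_ge0.
have := h1 'i%R; rewrite conjCi rmorphD !rmorphM /= rmorphN /= conjCi opprK => e1.
have := h1 1; rewrite rmorph1 !mul1r rmorphD /= => e2.
have e3 : 2 * (a - b^*%R) = 0.
  have -> : 2 * (a - b^*%R) = (a + b - (a^*%R + b^*%R)) + 'i%R * ((- 'i%R * a + 'i%R * b)
    - ('i%R * a^*%R + - 'i%R * b^*%R)) + ('i%R ^+ 2 + 1) * (a + a^*%R - b - b^*%R) by ring.
  by rewrite sqrCi addNr mul0r addr0 -e1 -e2 !subrr mulr0 addr0.
by apply/eqP; rewrite -subr_eq0; move/eqP: e3; rewrite mulf_eq0 pnatr_eq0.
Qed.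

Lemma le_sqrtCM (a b d : C) : 0 <= a -> 0 <= b -> `|d| ^+ 2 <= a * b ->
  `|d| <= sqrtC a * sqrtC b.
Proof.
move=> a0 b0 h; rewrite -ler_sqr ?nnegrE ?mulr_ge0 ?sqrtC_ge0//.
by rewrite exprMn !sqrtCK.
Qed.

Lemma sqrtC_triangle (a b d c : C) : 0 <= a -> 0 <= b -> `|d| <= sqrtC a * sqrtC b ->
  c = a + d + d^*%R + b -> 0 <= c -> sqrtC c <= sqrtC a + sqrtC b.
Proof.
move=> a0 b0 dab cE c0.
rewrite -ler_sqr ?nnegrE ?addr_ge0 ?sqrtC_ge0// sqrtCK sqrrD !sqrtCK cE lerD2r.
rewrite -addrA lerD2l; have dR : d + d^*%R \is Num.real.
  by apply/CrealP; rewrite rmorphD /= conjCK addrC.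
apply: le_trans (real_ler_norm dR) _; apply: le_trans (ler_normD _ _) _.
by rewrite norm_conjC mulr2n lerD.
Qed.

(** Completeness of the complex numbers, reduced to that of the real line by
    taking real and imaginary parts. *)
Lemma complex_cauchy_cvg (u : nat -> R[i]^o) :
  (forall e : C, 0 < e -> exists N, forall m n, (N <= m)%N -> (N <= n)%N ->
     `|u m - u n| <= e) -> cvgn u.
Proof.
move=> h.
have realc (v : nat -> R) :
    (forall m n, `|v m - v n|%:C <= `|u m - u n|) -> cvgn v.
  move=> hv; apply/cauchy_cvgP/cauchy_exP => e e0.
  have [|N hN] := h (e / 2)%:C; first by rewrite ltcR divr_gt0.
  exists (v N); exists N => // n Nn; rewrite -ball_normE /=.
  have := le_trans (hv N n) (hN N n (leqnn _) Nn); rewrite lecR => /le_lt_trans; apply.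
  by rewrite ltr_pdivrMr // ltr_pMr// ltr1n.
have ReD m n : `|complex.Re (u m) - complex.Re (u n)|%:C <= `|u m - u n|.
  have := normc_ge_Re (u m - u n).
  by case: (u m) (u n) => a b [c d].
have ImD m n : `|complex.Im (u m) - complex.Im (u n)|%:C <= `|u m - u n|.
  have := normc_ge_Re ((u m - u n) * 'i); rewrite ReiNIm normrN raddfB/=.
  rewrite normrM [X in _ <= _ * X](_ : _ = 1) ?mulr1//.
  by rewrite normc_def /= expr0n add0r expr1n sqrtr1.
have /cvg_ex[a /cvgrPdist_lt ha] := realc _ ReD.
have /cvg_ex[b /cvgrPdist_lt hb] := realc _ ImD.
apply/cvg_ex; exists (a +i* b : R[i]^o); apply/cvgrPdist_lt => /= e e0.
have e2 : 0 < complex.Re e / 2 by move: e0; rewrite ltcE => /andP[_ ?]; rewrite divr_gt0.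
near=> n.
have -> : e = (complex.Re e / 2 + complex.Re e / 2)%:C.
  by rewrite -splitr RRe_real// gtr0_real.
apply: (@le_lt_trans _ _ (`|a - complex.Re (u n)|%:C + `|b - complex.Im (u n)|%:C)); last first.
  rewrite -raddfD ltcR ltrD//; [near: n; exact: ha|near: n; exact: hb].
case: (u n) => p q /=; rewrite -[leLHS]/(`|((a - p) +i* (b - q))%C|).
rewrite [X in `|X|]complexE /=; apply: le_trans (ler_normD _ _) _.
rewrite normrM [X in _ + X * _]normc_def /= expr0n add0r expr1n sqrtr1 mul1r.
by rewrite !normc_def /= !expr0n !addr0 !sqrtr_sqr.
Unshelve. all: by end_near. Qed.

Lemma invSn_lt (e : C) : 0 < e -> \forall n \near \oo, n.+1%:R^-1 < e.
Proof.
move=> e0; have eE : e = (complex.Re e)%:C by rewrite RRe_real// gtr0_real.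
have e1 : 0 < complex.Re e by rewrite -ltcR -eE.
have := near_infty_natSinv_lt (PosNum e1); apply: filterS => n /=.
by rewrite eE -ltcR fmorphV /= rmorph_nat.
Qed.


Lemma cvg_invSn : (fun n => n.+1%:R^-1 : R[i]^o) @ \oo --> (0 : R[i]^o).
Proof.
apply/cvgrPdist_lt => e /invSn_lt; apply: filterS => n.
by rewrite sub0r normrN ger0_norm// invr_ge0 ler0n.
Qed.

(** The order of the complex numbers is partial, so that closedness of the
    nonnegative cone comes from its description as the set of the [z] with
    [`|z| = z]. *)
Lemma complex_cvg_ge0 (u : nat -> R[i]^o) (l : R[i]^o) :
  u @ \oo --> l -> (\forall n \near \oo, 0 <= u n) -> 0 <= l.
Proof.
move=> ul u0; rewrite ger0_def; apply/eqP.
have ul' : (fun n => `|u n| : R[i]^o) @ \oo --> (`|l| : R[i]^o) by exact: cvg_norm.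
apply: (norm_cvg_unique _ ul); apply: cvg_trans ul'; apply: near_eq_cvg.
by apply: filterS u0 => n; exact: ger0_norm.
Qed.

Lemma complex_cvg_le (u v : nat -> R[i]^o) (a b : R[i]^o) :
  u @ \oo --> a -> v @ \oo --> b -> (\forall n \near \oo, u n <= v n) -> a <= b.
Proof.
move=> ua vb uv; rewrite -subr_ge0; apply: (complex_cvg_ge0 (cvgB vb ua)).
by apply: filterS uv => n; rewrite subr_ge0.
Qed.

Lemma cvg_eq_seq (u v : nat -> R[i]^o) (l : R[i]^o) :
  u =1 v -> u @ \oo --> l -> v @ \oo --> l.
Proof. by move=> /funext ->. Qed.

Lemma cvg_conj (u : nat -> R[i]^o) (l : R[i]^o) :
  u @ \oo --> l -> (fun n => (u n)^*%R : R[i]^o) @ \oo --> (l^*%R : R[i]^o).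
Proof.
move=> /cvgrPdist_lt ul; apply/cvgrPdist_lt => e /ul; apply: filterS => n.
by rewrite -rmorphB norm_conjC.
Qed.
End scalars.

(** * Hilbert spaces: the Riesz theorem and adjoints *)

Section hilbert.
Variable R : realType.
Local Notation C := R[i].
Implicit Types H K : hilbertType R.

Lemma hdotC H (x y : H) : hdot x y = (hdot y x)^*%R.
Proof. by rewrite hermC mul1r. Qed.

Lemma hdot_sqD H (x y : H) (t : C) :
  hdot (x + t *: y) (x + t *: y) =
  hdot x x + t * hdot y x + (t * hdot y x)^*%R + t * t^*%R * hdot y y.
Proof.
rewrite !linearDl !linearD /= !linearZl_LR !linearZr_LR /= rmorphM /= -hdotC.
by ring.
Qed.

Lemma hdot_ge0 H (x : H) : 0 <= hdot x x.
Proof. by rewrite hdot_norm exprn_ge0. Qed.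

Lemma hdot_CauchySchwarz H (x y : H) : `|hdot x y| <= `|x| * `|y|.
Proof.
rewrite -(@ler_sqr _ `|hdot x y|) ?nnegrE ?mulr_ge0// exprMn -!hdot_norm mulrC.
by apply: discriminant_le; rewrite ?hdot_ge0// => t; rewrite -hdot_sqD hdot_ge0.
Qed.

Lemma hdot_injr H (x y : H) : (forall z, hdot z x = hdot z y) -> x = y.
Proof.
move=> h; apply/eqP; rewrite -subr_eq0 -normr_eq0 -sqrf_eq0 -hdot_norm.
by rewrite linearB /= h subrr.
Qed.

Lemma cvg_hdot H (x y : nat -> H) (a b : H) : x @ \oo --> a -> y @ \oo --> b ->
  (fun n => hdot (x n) (y n) : C^o) @ \oo --> (hdot a b : C^o).
Proof.
move=> xa yb.
have e0 : (fun n => `|a - x n| * `|y n| + `|a| * `|b - y n| : C^o) @ \oo --> (0 : C^o).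
  rewrite -(addr0 0) -[X in X + _](mul0r `|b|) -[X in _ + X](mulr0 `|a|).
  apply: cvgD; apply: cvgM.
  - by rewrite -(@normr0 _ H) -(subrr a); apply: cvg_norm; apply: cvgB => //; exact: cvg_cst.
  - exact: cvg_norm.
  - exact: cvg_cst.
  - by rewrite -(@normr0 _ H) -(subrr b); apply: cvg_norm; apply: cvgB => //; exact: cvg_cst.
apply/cvgrPdist_lt => e e1; move/cvgrPdist_lt: e0 => /(_ _ e1); apply: filterS => n.
apply: le_lt_trans; rewrite sub0r normrN [leRHS]ger0_norm ?addr_ge0 ?mulr_ge0//.
have -> : hdot a b - hdot (x n) (y n) = hdot (a - x n) (y n) + hdot a (b - y n).
  by rewrite linearBl linearB /=; ring.
by apply: le_trans (ler_normD _ _) _; apply: lerD; exact: hdot_CauchySchwarz.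
Qed.

Lemma normed_cauchy_cvg H (u : nat -> H) :
  (forall e : C, 0 < e -> exists N, forall m n, (N <= m)%N -> (N <= n)%N ->
     `|u m - u n| <= e) -> cvgn u.
Proof.
move=> h; apply/cauchy_cvgP/cauchy_exP => e e0.
have [|N hN] := h (e / 2); first by rewrite divr_gt0.
exists (u N); exists N => // n Nn; rewrite -ball_normE /=.
apply: le_lt_trans (hN _ _ (leqnn _) Nn) _.
by rewrite ltr_pdivrMr // ltr_pMr// ltr1n.
Qed.

(** Continuity and closure arguments on Hilbert spaces are made with
    sequences; this lemma is what allows it. *)
Lemma closure_seq H (A : set H) x : closure A x ->
  exists u : nat -> H, (forall n, A (u n)) /\ u @ \oo --> x.
Proof.
move=> Ax; have /choice[u hu] : forall n, exists y, A y /\ `|x - y| < n.+1%:R^-1.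
  move=> n; have n0 : 0 < n.+1%:R^-1 :> C by rewrite invr_gt0 ltr0n.
  have [y [Ay xy]] := Ax _ (nbhsx_ballx x _ n0).
  by exists y; split => //; rewrite -ball_normE in xy.
exists u; split => [n|]; first by have [] := hu n.
apply/cvgrPdist_lt => e /invSn_lt; apply: filterS => n; apply: lt_trans.
by have [] := hu n.
Qed.

Lemma bounded_opP H K (A : bounded_op H K) :
  exists2 M : C, 0 < M & forall x, `|A x| <= M * `|x|.
Proof.
by have /linear_boundedP/pinfty_ex_gt0[M M0 hM] := bounded_op_bounded A; exists M.
Qed.

Lemma cvg_bounded_op H K (A : bounded_op H K) (u : nat -> H) (x : H) :
  u @ \oo --> x -> (A \o u) @ \oo --> A x.
Proof.
by move=> ux; apply: cvg_comp ux _; exact: bounded_linear_continuous (bounded_op_bounded A) x.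
Qed.

Lemma bounded_op_exists H K (f : H -> K) (M : C) : linear f -> 0 <= M ->
  (forall x, `|f x| <= M * `|x|) -> exists A : bounded_op H K, A =1 f.
Proof.
move=> lf M0 hf; pose mx := GRing.isLinear.Build _ _ _ _ f lf.
pose F : {linear H -> K} := HB.pack f mx.
have FB : bounded_near F (nbhs (0 : H)).
  apply/bounded_funP => r; exists (M * r) => x xr.
  by apply: le_trans (hf x) _; rewrite ler_wpM2l.
by exists (BoundedOp FB).
Qed.

(** Equality of operators as records is needed because self-adjointness of
    [J] is stated as an equality between operators. *)
Lemma bounded_op_eq H K (A B : bounded_op H K) : A =1 B -> A = B.
Proof.
case: A B => [[f [[pf] [qf]]] bf] [[g [[pg] [qg]]] bg] /= /funext fg.
move: pf qf bf; rewrite fg => pf qf bf.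
rewrite (Prop_irrelevance pf pg) (Prop_irrelevance qf qg) in bf *.
by rewrite (Prop_irrelevance bf bg).
Qed.

Lemma eq_total H K (S : set H) (A B : bounded_op H K) :
  closed_lin_span S = setT -> (forall x, S x -> A x = B x) -> A =1 B.
Proof.
move=> ST AB x; have : closed_lin_span S x by rewrite ST.
move=> /closure_seq[u [uS ux]].
have Au := @cvg_bounded_op _ _ A _ _ ux; have Bu := @cvg_bounded_op _ _ B _ _ ux.
suff E : A \o u = B \o u by rewrite E in Au; exact: norm_cvg_unique Au Bu.
apply/funext => n /=; have [m [c [v [vS ->]]]] := uS n.
by rewrite !linear_sum; apply: eq_bigr => i _; rewrite !linearZ /= AB.
Qed.

(** The representing vector minimises [Q y = |y|^2 - 2 Re (f y)]: a minimising
    sequence is Cauchy by the parallelogram identity, and the first variation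
    of [Q] at its limit vanishes: along the sequence it is bounded, through
    [discriminant_le], by the distance of [Q (y n)] to the infimum. *)
Lemma riesz_representation H (f : H -> C) (M : C) : 0 <= M ->
  (forall a x y, f (a *: x + y) = a * f x + f y) ->
  (forall x, `|f x| <= M * `|x|) -> exists u, forall x, f x = hdot x u.
Proof.
move=> M0 lf hf.
have f0 : f 0 = 0.
  by apply/eqP; rewrite -normr_le0; have := hf 0; rewrite normr0 mulr0.
have lfZ a x : f (a *: x) = a * f x by rewrite -[a *: x]addr0 lf f0 addr0.
have lfD x y : f (x + y) = f x + f y by rewrite -[x]scale1r lf mul1r scale1r.
pose Q y : C := hdot y y - f y - (f y)^*%R.
pose q y : R := complex.Re (Q y).
have qE y : Q y = (q y)%:C.
  rewrite RRe_real//; apply/CrealP; rewrite /Q !rmorphB /= conjCK -hdotC.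
  by ring.
(* Complete the square: [Q y + M^2] is at least [(M - |y|)^2]. *)
have Q_ge y : - M ^+ 2 <= Q y.
  have fr : f y + (f y)^*%R <= 2 * (M * `|y|).
    have fR : f y + (f y)^*%R \is Num.real.
      by apply/CrealP; rewrite rmorphD /= conjCK addrC.
    apply: le_trans (real_ler_norm fR) _; apply: le_trans (ler_normD _ _) _.
    by rewrite norm_conjC mulr_natl mulr2n lerD.
  have sq : 0 <= (M - `|y|) ^+ 2 by rewrite real_exprn_even_ge0// rpredB ?ger0_real.
  rewrite -subr_ge0; apply: (le_trans sq); rewrite /Q hdot_norm -subr_ge0.
  move: fr; rewrite -subr_ge0; congr (0 <= _).
  by ring.
have [m mQ hm] : exists2 m : C, forall y, m <= Q y &
    forall n, exists y, Q y <= m + n.+1%:R^-1.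
  have q_inf : has_inf (range q).
    split; first by exists (q 0); exists 0.
    exists (complex.Re (- M ^+ 2)) => _ [z _ <-].
    by rewrite -lecR -qE RRe_real// rpredN rpredX// ger0_real.
  exists (inf (range q))%:C => [y|n].
    by rewrite qE lecR; apply: ge_inf; [case: q_inf | exists y].
  have n0 : 0 < n.+1%:R^-1 :> R by rewrite invr_gt0 ltr0n.
  have [_ [y _ <-] qy] := inf_adherent n0 q_inf.
  exists y; rewrite qE; move/ltW: qy; rewrite -lecR => /le_trans; apply.
  by rewrite rmorphD /= fmorphV /= rmorph_nat.
have /choice[y hy] := hm.
have QD z t x : Q (z + t *: x) = Q z + t * (hdot x z - f x) +
    (t * (hdot x z - f x))^*%R + t * t^*%R * hdot x x.
  rewrite /Q hdot_sqD lfD lfZ !(rmorphD, rmorphB, rmorphM, rmorphN) /=.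
  by ring.
(* The parallelogram identity at the midpoint [z] of [y k] and [y n], with
   [w] half of their difference. *)
have Qmid k n : hdot (y k - y n) (y k - y n) <= 2 * (k.+1%:R^-1 + n.+1%:R^-1).
  have [z [w [-> yk yn]]] : exists z w,
      [/\ y k - y n = 2 *: w, y k = z + 1 *: w & y n = z + (-1) *: w].
    exists (2^-1 *: (y k + y n)), (2^-1 *: (y k - y n)).
    have half (v : H) : 2^-1 *: (v + v) = v.
      by rewrite -{1 2}[v]scale1r -scalerDl scalerA mulVf ?scale1r.
    split; first by rewrite scalerA mulfV ?scale1r.
      by rewrite scale1r -scalerDr addrACA subrr addr0 half.
    by rewrite scaleN1r -scalerBr opprB addrC addrA subrK half.
  have h1 : 0 <= Q z - m by rewrite subr_ge0.
  have h2 := lerD (hy k) (hy n); rewrite -subr_ge0 in h2.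
  have := addr_ge0 (addr_ge0 h1 h1) h2; rewrite yk yn !QD rmorphN rmorph1 => h3.
  rewrite -subr_ge0 linearZl_LR linearZr_LR /= conjC_nat.
  have := addr_ge0 h3 h3; congr (0 <= _).
  by rewrite !(mul1r, mulN1r, rmorphN) /=; ring.
have yc : cvgn y.
  apply: normed_cauchy_cvg => e e0.
  have [|N _ hN] := invSn_lt (e := e ^+ 2 / 4).
    by rewrite divr_gt0// exprn_gt0.
  exists N => k n Nk Nn; rewrite -ler_sqr ?nnegrE ?(ltW e0)//.
  rewrite -[leLHS]hdot_norm (le_trans (Qmid k n))//.
  have /ltW hk := hN k Nk; have /ltW hn := hN n Nn.
  apply: le_trans (_ : 2 * (e ^+ 2 / 4 + e ^+ 2 / 4) <= _).
    by rewrite ler_pM2l// lerD.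
  by rewrite [leLHS](_ : _ = e ^+ 2)//; field.
pose u : H := lim (y @ \oo); have yu : y @ \oo --> u := yc.
exists u => x; apply/eqP; rewrite eq_sym -subr_eq0 -normr_eq0.
(* [Q (y n + t *: x) - Q (y n)] is at least [- n.+1%:R^-1] for every [t]. *)
have hd n : `|hdot x (y n) - f x| ^+ 2 <= n.+1%:R^-1 * hdot x x.
  apply: discriminant_le; rewrite ?hdot_ge0// ?invr_ge0 ?ler0n// => t.
  rewrite [X in 0 <= X](_ : _ = (m + n.+1%:R^-1 - Q (y n)) + (Q (y n + t *: x) - m)).
    by rewrite addr_ge0 ?subr_ge0.
  by rewrite QD; ring.
have dn : (fun n => `|hdot x (y n) - f x| : C^o) @ \oo --> (`|hdot x u - f x| : C^o).
  apply: cvg_norm; apply: (cvgB (cvg_hdot _ yu)); exact: cvg_cst.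
have en : (fun n => n.+1%:R^-1 * hdot x x : C^o) @ \oo --> (0 * hdot x x : C^o).
  by apply: cvgM; [exact: cvg_invSn | exact: cvg_cst].
have h := complex_cvg_le (cvgM dn dn) en.
rewrite mul0r -expr2 in h.
have {}h : `|hdot x u - f x| ^+ 2 <= 0.
  apply: h; apply: nearW => n.
  by rewrite /= -[_ * _ in leLHS]expr2 hd.
by rewrite -sqrf_eq0 eq_le h exprn_ge0.
Qed.

Lemma adjoint_exists H K (A : bounded_op H K) :
  exists B : bounded_op K H, forall x y, hdot (A x) y = hdot x (B y).
Proof.
have [M M0 hM] := bounded_opP A.
have hA x y : `|hdot (A x) y| <= M * `|y| * `|x|.
  by rewrite mulrAC (le_trans (hdot_CauchySchwarz _ _))// ler_wpM2r.
have /choice[B hB] : forall y, exists u, forall x, hdot (A x) y = hdot x u.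
  move=> y; apply: riesz_representation (hA^~ y) => [|a x x'].
    by rewrite mulr_ge0 ?(ltW M0).
  by rewrite linearP linearDl linearZl_LR.
have [|y|B' BB'] := @bounded_op_exists _ _ B M _ (ltW M0).
- move=> a y y'; apply: hdot_injr => x.
  by rewrite -hB !linearD /= !linearZr_LR /= !hB.
- have [->|By0] := eqVneq (B y) 0; first by rewrite normr0 mulr_ge0 ?(ltW M0).
  rewrite -(ler_pM2r (x := `|B y|)) ?normr_gt0//.
  by have := hA (B y) y; rewrite hB ger0_norm ?hdot_ge0// hdot_norm expr2.
by exists B' => x y; rewrite BB'.
Qed.

Lemma adjointP H K (A : bounded_op H K) x y : hdot (A x) y = hdot x (adjoint A y).
Proof.
rewrite /adjoint; case: xgetP => [B _ /= ->//|none].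
by have [B hB] := adjoint_exists A; have := none B.
Qed.
End hilbert.

(** * Linear combinations and bounded extension from a total family *)

Section lincomb.
Variables (R : realType) (X : Type).
Local Notation C := R[i].
Implicit Types (s t : seq (C * X)).

(** Formal linear combinations are lists of pairs (coefficient, point); they
    are only ever looked at through maps [f : X -> V], so that no quotient to
    the free module is taken. *)
Definition lincomb (V : lmodType C) (f : X -> V) s : V :=
  \sum_(p <- s) p.1 *: f p.2.

Definition scale_comb (a : C) s : seq (C * X) := [seq (a * p.1, p.2) | p <- s].

Definition sub_comb s t := s ++ scale_comb (-1) t.

Variables (V : lmodType C) (f : X -> V).

Lemma lincomb_cat s t : lincomb f (s ++ t) = lincomb f s + lincomb f t.
Proof. exact: big_cat. Qed.

Lemma lincomb_scale a s : lincomb f (scale_comb a s) = a *: lincomb f s.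
Proof.
rewrite /lincomb big_map scaler_sumr; apply: eq_bigr => p _.
by rewrite scalerA.
Qed.

Lemma lincombB s t : lincomb f (sub_comb s t) = lincomb f s - lincomb f t.
Proof. by rewrite lincomb_cat lincomb_scale scaleN1r. Qed.

Lemma lincomb1 x : lincomb f [:: (1, x)] = f x.
Proof. by rewrite /lincomb big_seq1 scale1r. Qed.

End lincomb.

Section extension.
Variables (R : realType) (X : Type).
Local Notation C := R[i].

Lemma lin_span_lincomb (E : hilbertType R) (i : X -> E) x :
  lin_span (range i) x <-> exists s, x = lincomb i s.
Proof.
split=> [[n [c [v [vi ->]]]]|[s ->]].
  have /choice[w iw] : forall j, exists y, i y = v j.
    by move=> j; have [y _ <-] := vi j; exists y.
  exists [seq (c j, w j) | j <- enum 'I_n].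
  by rewrite /lincomb big_map big_enum /=; apply: eq_bigr => j _; rewrite iw.
exists (size s), (fun j => (tnth (in_tuple s) j).1), (fun j => i (tnth (in_tuple s) j).2).
split; first by move=> j; exists (tnth (in_tuple s) j).2.
by rewrite /lincomb big_tnth.
Qed.

(** A map defined on a total family extends to a bounded operator as soon as
    it is bounded on finite linear combinations. The value at [x] is the limit
    of [lincomb t (S n)] for a sequence of combinations with
    [lincomb i (S n)] tending to [x]; by the bound it exists and depends on
    [x] only. In particular the bound makes [t] compatible with the linear
    relations between the vectors [i x]. *)
Theorem bounded_extension (E K : hilbertType R) (i : X -> E) (t : X -> K) (M : C) :
  0 <= M -> closed_lin_span (range i) = setT ->
  (forall s, `|lincomb t s| <= M * `|lincomb i s|) ->
  exists T : bounded_op E K, forall x, T (i x) = t x.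
Proof.
move=> M0 itot Mt.
have t0 (S : nat -> seq (C * X)) :
    (fun n => lincomb i (S n)) @ \oo --> (0 : E) ->
    (fun n => lincomb t (S n)) @ \oo --> (0 : K).
  move=> /cvgrPdist_lt S0; apply/cvgrPdist_lt => e e0.
  have M1 : 0 < M + 1 by rewrite ltr_wpDl.
  have := S0 (e / (M + 1)); rewrite divr_gt0// => /(_ isT).
  apply: filterS => n; rewrite !sub0r !normrN ltr_pdivlMr// mulrC.
  by apply: le_lt_trans; rewrite (le_trans (Mt _))// ler_wpM2r// lerDl.
have tcvg (S : nat -> seq (C * X)) (x : E) :
    (fun n => lincomb i (S n)) @ \oo --> x -> cvgn (fun n => lincomb t (S n)).
  move=> /cvgrPdist_lt Sx; apply: normed_cauchy_cvg => e e0.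
  have M1 : 0 < M + 1 by rewrite ltr_wpDl.
  have e1 : 0 < e / (M + 1) by rewrite divr_gt0.
  have [|N _ hN] := Sx (e / (M + 1) / 2); first by rewrite divr_gt0.
  exists N => m n Nm Nn; rewrite -lincombB (le_trans (Mt _))//.
  apply: (@le_trans _ _ ((M + 1) * `|lincomb i (sub_comb (S m) (S n))|)).
    by rewrite ler_wpM2r// lerDl.
  rewrite mulrC -ler_pdivlMr// lincombB (splitr (e / _)).
  rewrite (le_trans (ler_distD x _ _))// lerD//; apply: ltW; last exact: hN.
  by rewrite distrC; exact: hN.
have /choice[S hS] : forall x : E, exists S : nat -> seq (C * X),
    (fun n => lincomb i (S n)) @ \oo --> x.
  move=> x; have : closed_lin_span (range i) x by rewrite itot.
  move=> /closure_seq[u [uspan ux]].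
  have /choice[S uS] : forall n, exists s, u n = lincomb i s.
    by move=> n; apply/lin_span_lincomb.
  by exists S; rewrite (_ : (fun n => _) = u)//; apply/funext => n; rewrite uS.
pose T (x : E) : K := lim ((fun n => lincomb t (S x n)) @ \oo).
have TP (S' : nat -> seq (C * X)) (x : E) :
    (fun n => lincomb i (S' n)) @ \oo --> x ->
    (fun n => lincomb t (S' n)) @ \oo --> T x.
  move=> S'x; rewrite -[T x]add0r.
  have -> : (fun n => lincomb t (S' n)) =
     (fun n => lincomb t (sub_comb (S' n) (S x n)) + lincomb t (S x n)).
    by apply/funext => n; rewrite lincombB subrK.
  apply: cvgD; last exact: tcvg (hS x).
  apply: t0; rewrite -(subrr x).
  rewrite (_ : (fun n => _) = (fun n => lincomb i (S' n) - lincomb i (S x n))).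
    by apply: cvgB.
  by apply/funext => n; rewrite lincombB.
have Tlin : linear (T : E -> K).
  move=> a x y.
  have hxy : (fun n => lincomb i (scale_comb a (S x n) ++ S y n)) @ \oo --> a *: x + y.
    rewrite (_ : (fun n => _) = (fun n => a *: lincomb i (S x n) + lincomb i (S y n))).
      by apply: cvgD => //; apply: cvgZr.
    by apply/funext => n; rewrite lincomb_cat lincomb_scale.
  have := TP _ _ hxy.
  rewrite (_ : (fun n => _) = (fun n => a *: lincomb t (S x n) + lincomb t (S y n))).
    move=> h; apply: norm_cvg_unique h _.
    by apply: cvgD; [apply: cvgZr |]; exact: TP.
  by apply/funext => n; rewrite lincomb_cat lincomb_scale.
have TM x : `|T x| <= M * `|x|.
  have h1 : (fun n => `|lincomb t (S x n)| : C^o) @ \oo --> (`|T x| : C^o).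
    by apply: cvg_norm; exact: TP.
  have h2 : (fun n => M * `|lincomb i (S x n)| : C^o) @ \oo --> (M * `|x| : C^o).
    by apply: cvgM; [exact: cvg_cst | exact: cvg_norm].
  by apply: complex_cvg_le h1 h2 _; apply: nearW => n.
have [A AT] := bounded_op_exists Tlin M0 TM; exists A => x; rewrite AT.
have := TP (fun=> [:: (1, x)]) (i x); rewrite !lincomb1 => h.
by apply: norm_cvg_unique (h _) _; exact: cvg_cst.
Qed.
End extension.

(** * Positive definite kernels and their forms *)

(** Positivity is part of the data so that the structures of the space
    constructed below can be found from the kernel alone. *)
Record posdef_kernel (R : realType) (X : Type) := PosDefKernel {
  kernel_fun :> X -> X -> R[i] ;
  kernel_pos : forall s : seq (R[i] * X),
    0 <= \sum_(p <- s) \sum_(q <- s) p.1 * q.1^*%R * kernel_fun p.2 q.2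
}.

Section kernel_form.
Variables (R : realType) (X : Type) (k : posdef_kernel R X).
Local Notation C := R[i].
Implicit Types (s t u : seq (C * X)) (S T : nat -> seq (C * X)).

Definition kernel_comb s : X -> C^o := lincomb (k : X -> X -> C^o) s.

(** The sesquilinear form on formal combinations for which two points have
    inner product [k x y]. Through [kernel_comb] a combination acts on points
    as its inner product with them. *)
Definition kernel_form s t : C := \sum_(q <- t) q.1^*%R * kernel_comb s q.2.

Lemma kernel_combE s y : kernel_comb s y = \sum_(p <- s) p.1 * k p.2 y.
Proof. by rewrite /kernel_comb /lincomb fct_sumE. Qed.

Lemma kernel_formE s t :
  kernel_form s t = \sum_(p <- s) \sum_(q <- t) p.1 * q.1^*%R * k p.2 q.2.
Proof.
rewrite exchange_big /=; apply: eq_bigr => q _; rewrite kernel_combE mulr_sumr.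
by apply: eq_bigr => p _; ring.
Qed.

Lemma kernel_form_ge0 s : 0 <= kernel_form s s.
Proof. by rewrite kernel_formE kernel_pos. Qed.

Lemma kernelC x y : k x y = (k y x)^*%R.
Proof.
have k0 z : 0 <= k z z.
  by have := kernel_pos k [:: (1, z)]; rewrite !big_seq1 /= mul1r rmorph1 mul1r.
apply: (hermitian_of_pos (k0 x) (k0 y)) => t.
have := kernel_pos k [:: (1, x); (t, y)].
rewrite !big_cons !big_nil /= rmorph1; congr (0 <= _).
by ring.
Qed.

Lemma kernel_formC s t : kernel_form s t = (kernel_form t s)^*%R.
Proof.
rewrite !kernel_formE exchange_big rmorph_sum /=; apply: eq_bigr => q _.
rewrite rmorph_sum; apply: eq_bigr => p _.
by rewrite kernelC !rmorphM /= conjCK; ring.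
Qed.

Lemma kernel_form_cat s t u :
  kernel_form (s ++ t) u = kernel_form s u + kernel_form t u.
Proof. by rewrite !kernel_formE big_cat. Qed.

Lemma kernel_form_scale a s t :
  kernel_form (scale_comb a s) t = a * kernel_form s t.
Proof.
rewrite !kernel_formE big_map mulr_sumr; apply: eq_bigr => p _ /=.
by rewrite mulr_sumr; apply: eq_bigr => q _; ring.
Qed.

Lemma kernel_formBl s t u :
  kernel_form (sub_comb s t) u = kernel_form s u - kernel_form t u.
Proof. by rewrite kernel_form_cat kernel_form_scale mulN1r. Qed.

Lemma kernel_formBr s t u :
  kernel_form u (sub_comb s t) = kernel_form u s - kernel_form u t.
Proof. by rewrite kernel_formC kernel_formBl rmorphB /= -!kernel_formC. Qed.

Lemma kernel_form1 s y : kernel_form s [:: (1, y)] = kernel_comb s y.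
Proof. by rewrite /kernel_form big_seq1 rmorph1 mul1r. Qed.

Lemma kernel_form_sqD s t a :
  kernel_form (s ++ scale_comb a t) (s ++ scale_comb a t) =
  kernel_form s s + a * kernel_form t s + (a * kernel_form t s)^*%R
    + a * a^*%R * kernel_form t t.
Proof.
rewrite kernel_form_cat kernel_form_scale.
rewrite [kernel_form s (_ ++ _)]kernel_formC [kernel_form t (_ ++ _)]kernel_formC.
rewrite !kernel_form_cat !kernel_form_scale !rmorphD !rmorphM /=.
rewrite -!kernel_formC [kernel_form s t]kernel_formC.
by ring.
Qed.

Definition kernel_norm s : C := sqrtC (kernel_form s s).

Lemma kernel_norm_ge0 s : 0 <= kernel_norm s.
Proof. by rewrite sqrtC_ge0 kernel_form_ge0. Qed.

Lemma kernel_CauchySchwarz s t : `|kernel_form s t| <= kernel_norm s * kernel_norm t.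
Proof.
apply: le_sqrtCM; rewrite ?kernel_form_ge0// mulrC.
apply: discriminant_le; rewrite ?kernel_form_ge0// => a.
by rewrite -kernel_form_sqD kernel_form_ge0.
Qed.

Lemma kernel_norm_cat s t : kernel_norm (s ++ t) <= kernel_norm s + kernel_norm t.
Proof.
apply: (sqrtC_triangle (d := kernel_form t s)); rewrite ?kernel_form_ge0//.
  by rewrite mulrC kernel_CauchySchwarz.
rewrite kernel_form_cat.
rewrite [kernel_form s (_ ++ _)]kernel_formC [kernel_form t (_ ++ _)]kernel_formC.
rewrite !kernel_form_cat !rmorphD /= -!kernel_formC [kernel_form s t]kernel_formC.
by ring.
Qed.

Lemma kernel_norm_scale a s : kernel_norm (scale_comb a s) = `|a| * kernel_norm s.
Proof.
rewrite /kernel_norm kernel_form_scale kernel_formC kernel_form_scale rmorphM /=.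
by rewrite -kernel_formC mulrA -normCK sqrtCM ?nnegrE ?exprn_ge0 ?kernel_form_ge0// sqrCK.
Qed.

Definition kernel_cauchy S := forall e : C, 0 < e ->
  exists N, forall m n, (N <= m)%N -> (N <= n)%N ->
    kernel_norm (sub_comb (S m) (S n)) <= e.

(** The form only sees the functions [kernel_comb s]; this replaces the
    vector space axioms that lists do not satisfy. *)
Lemma kernel_form_ext s s' t t' : kernel_comb s = kernel_comb s' ->
  kernel_comb t = kernel_comb t' -> kernel_form s t = kernel_form s' t'.
Proof.
move=> ss tt; rewrite {1}/kernel_form ss -/(kernel_form s' t).
by rewrite kernel_formC {1}/kernel_form tt -/(kernel_form t' s') -kernel_formC.
Qed.

Lemma kernel_comb_cat s t : kernel_comb (s ++ t) = kernel_comb s + kernel_comb t.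
Proof. exact: lincomb_cat. Qed.

Lemma kernel_comb_scale a s : kernel_comb (scale_comb a s) = a *: kernel_comb s.
Proof. exact: lincomb_scale. Qed.

Lemma kernel_combB s t : kernel_comb (sub_comb s t) = kernel_comb s - kernel_comb t.
Proof. exact: lincombB. Qed.

Lemma kernel_norm_ext s s' : kernel_comb s = kernel_comb s' ->
  kernel_norm s = kernel_norm s'.
Proof. by move=> ss; rewrite /kernel_norm (kernel_form_ext ss ss). Qed.

Lemma kernel_cauchy_bounded S : kernel_cauchy S ->
  exists2 B : C, 0 < B & \forall n \near \oo, kernel_norm (S n) <= B.
Proof.
move=> /(_ 1 ltr01)[N hN]; exists (1 + kernel_norm (S N)).
  by rewrite ltr_wpDr ?kernel_norm_ge0.
exists N => // n Nn; have := hN _ _ Nn (leqnn N); rewrite -(lerD2r (kernel_norm (S N))).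
apply: le_trans; apply: le_trans (kernel_norm_cat _ _).
by rewrite (kernel_norm_ext (s' := S n))// kernel_comb_cat kernel_combB subrK.
Qed.

Lemma kernel_cauchy_lin a S T : kernel_cauchy S -> kernel_cauchy T ->
  kernel_cauchy (fun n => scale_comb a (S n) ++ T n).
Proof.
move=> cS cT e e0.
have a1 : 0 < `|a| + 1 by rewrite ltr_wpDl.
have [|N hN] := cS (e / 2 / (`|a| + 1)); first by rewrite !divr_gt0.
have [|M hM] := cT (e / 2); first by rewrite divr_gt0.
exists (maxn N M) => m n; rewrite !geq_max => /andP[Nm Mm] /andP[Nn Mn].
rewrite (kernel_norm_ext
  (s' := scale_comb a (sub_comb (S m) (S n)) ++ sub_comb (T m) (T n))); last first.
  rewrite !(kernel_comb_cat, kernel_combB, kernel_comb_scale) scalerBr.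
  by rewrite opprD addrACA.
rewrite (le_trans (kernel_norm_cat _ _))// (splitr e) lerD ?hM// kernel_norm_scale.
apply: (@le_trans _ _ ((`|a| + 1) * kernel_norm (sub_comb (S m) (S n)))).
  by rewrite ler_wpM2r ?kernel_norm_ge0// lerDl.
by rewrite mulrC -ler_pdivlMr// hN.
Qed.

Lemma kernel_form_cvg S T : kernel_cauchy S -> kernel_cauchy T ->
  cvgn (fun n => kernel_form (S n) (T n) : C^o).
Proof.
move=> cS cT; apply: complex_cauchy_cvg => e e0.
have [A A0 [N0 _ hA]] := kernel_cauchy_bounded cS.
have [B B0 [N1 _ hB]] := kernel_cauchy_bounded cT.
have [|N2 h2] := cS (e / 2 / B); first by rewrite !divr_gt0.
have [|N3 h3] := cT (e / 2 / A); first by rewrite !divr_gt0.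
exists (maxn (maxn N0 N1) (maxn N2 N3)) => m n; rewrite !geq_max.
move=> /andP[/andP[m0 m1] /andP[m2 m3]] /andP[/andP[n0 n1] /andP[n2 n3]].
have -> : kernel_form (S m) (T m) - kernel_form (S n) (T n) =
  kernel_form (sub_comb (S m) (S n)) (T m) + kernel_form (S n) (sub_comb (T m) (T n)).
  by rewrite kernel_formBl kernel_formBr; ring.
apply: le_trans (ler_normD _ _) _; rewrite (splitr e); apply: lerD.
  apply: le_trans (kernel_CauchySchwarz _ _) _.
  rewrite -[leRHS](divfK (lt0r_neq0 B0)).
  by apply: ler_pM; rewrite ?kernel_norm_ge0 ?h2 ?hB.
apply: le_trans (kernel_CauchySchwarz _ _) _.
rewrite mulrC -[leRHS](divfK (lt0r_neq0 A0)).
by apply: ler_pM; rewrite ?kernel_norm_ge0 ?h3 ?hA.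
Qed.

Lemma kernel_form_cvgl S (f : X -> C^o) t :
  (forall y, (fun n => kernel_comb (S n) y) @ \oo --> f y) ->
  (fun n => kernel_form (S n) t : C^o) @ \oo --> (\sum_(q <- t) q.1^*%R * f q.2 : C^o).
Proof.
move=> Sf; rewrite /kernel_form; elim: t => [|q t IH].
  rewrite big_nil (_ : (fun n => _) = cst 0); first exact: cvg_cst.
  by apply/funext => n; rewrite big_nil.
rewrite big_cons (_ : (fun n => _) = fun n => q.1^*%R * kernel_comb (S n) q.2 +
    \sum_(p <- t) p.1^*%R * kernel_comb (S n) p.2); last first.
  by apply/funext => n; rewrite big_cons.
have h1 : (fun n => q.1^*%R * kernel_comb (S n) q.2 : C^o) @ \oo -->
    (q.1^*%R * f q.2 : C^o) by exact: (cvgM (cvg_cst (q.1^*%R : C^o)) (Sf q.2)).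
exact: cvgD h1 IH.
Qed.

(** A Cauchy sequence whose functions tend to 0 pointwise is null for the
    form: [T n] may be replaced by a fixed [T N] up to a small error, and
    pairing with a fixed combination is a pointwise limit. This is why the
    completion can be realized inside the functions on [X]. *)
Lemma kernel_form_null S T : kernel_cauchy S -> kernel_cauchy T ->
  (forall y, (fun n => kernel_comb (S n) y) @ \oo --> (0 : C^o)) ->
  (fun n => kernel_form (S n) (T n) : C^o) @ \oo --> (0 : C^o).
Proof.
move=> cS cT S0; apply/cvgrPdist_lt => e e0.
have [A A0 hA] := kernel_cauchy_bounded cS.
have [|N h3] := cT (e / 2 / A); first by rewrite !divr_gt0.
have := @kernel_form_cvgl S (cst 0) (T N) S0.
rewrite big1 => [/cvgrPdist_lt /(_ (e / 2))|q _]; last by rewrite mulr0.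
rewrite divr_gt0// => /(_ isT) hF.
near=> n.
rewrite sub0r normrN.
have -> : kernel_form (S n) (T n) =
    kernel_form (S n) (T N) + kernel_form (S n) (sub_comb (T n) (T N)).
  by rewrite kernel_formBr addrC subrK.
rewrite (splitr e); apply: le_lt_trans (ler_normD _ _) _; apply: ltr_leD.
  by rewrite -normrN -sub0r; near: n.
apply: le_trans (kernel_CauchySchwarz _ _) _.
rewrite mulrC -[leRHS](divfK (lt0r_neq0 A0)).
apply: ler_pM; rewrite ?kernel_norm_ge0//; last by near: n.
by apply: h3 => //; near: n; exists N.
Unshelve. all: by end_near. Qed.

Definition kernel_limit S (f : X -> C^o) :=
  kernel_cauchy S /\ forall y, (fun n => kernel_comb (S n) y) @ \oo --> f y.

Lemma kernel_limit_lin a S T f g : kernel_limit S f -> kernel_limit T g ->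
  kernel_limit (fun n => scale_comb a (S n) ++ T n) (a *: f + g).
Proof.
move=> [cS Sf] [cT Tg]; split; first exact: kernel_cauchy_lin.
move=> y; rewrite (_ : (fun n => _) = fun n =>
  a *: (kernel_comb (S n) y : C^o) + kernel_comb (T n) y).
  by apply: cvgD => //; apply: cvgZr.
by apply/funext => n; rewrite kernel_comb_cat kernel_comb_scale.
Qed.

Lemma kernel_limit_cst s : kernel_limit (fun=> s) (kernel_comb s).
Proof.
split=> [e e0|y]; last exact: cvg_cst.
exists 0 => m n _ _; rewrite /kernel_norm kernel_formBl subrr sqrtC0.
exact: ltW.
Qed.

(** The completion of the space of combinations, as a space of functions: the
    pointwise limits of Cauchy sequences. Equality of functions does the work
    of the quotient by null vectors. *)
Definition rkhs_pred : {pred (X -> C^o)} := [pred f | `[< exists S, kernel_limit S f >]].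

Lemma rkhs_predP f : reflect (exists S, kernel_limit S f) (f \in rkhs_pred).
Proof. exact: asboolP. Qed.

Lemma rkhs_submod_closed : submod_closed rkhs_pred.
Proof.
split=> [|a f g /rkhs_predP[S hS] /rkhs_predP[T hT]]; apply/rkhs_predP.
  exists (fun=> [::]); rewrite (_ : 0 = kernel_comb [::]).
    exact: kernel_limit_cst.
  by rewrite /kernel_comb /lincomb big_nil.
by exists (fun n => scale_comb a (S n) ++ T n); exact: kernel_limit_lin.
Qed.

HB.instance Definition _ :=
  GRing.isSubmodClosed.Build C (X -> C^o) rkhs_pred rkhs_submod_closed.

Record rkhs := Rkhs { rkhs_fun :> X -> C^o ; rkhs_funP : rkhs_fun \in rkhs_pred }.
HB.instance Definition _ := [isSub for rkhs_fun].
HB.instance Definition _ := [Choice of rkhs by <:].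
HB.instance Definition _ := [SubChoice_isSubLmodule of rkhs by <:].

End kernel_form.

(** * The reproducing kernel Hilbert space *)

Section rkhs_dot.
Variables (R : realType) (X : Type) (k : posdef_kernel R X).
Local Notation C := R[i].
Implicit Types (s t u : seq (C * X)) (S T : nat -> seq (C * X)) (f g : rkhs k).

Definition rkhs_approx f : nat -> seq (C * X) :=
  projT1 (cid (elimT (@rkhs_predP R X k f) (rkhs_funP f))).

Lemma rkhs_approxP f : kernel_limit k (rkhs_approx f) f.
Proof. by rewrite /rkhs_approx; case: cid. Qed.

Definition rkhs_dot f g : C :=
  lim ((fun n => kernel_form k (rkhs_approx f n) (rkhs_approx g n) : C^o) @ \oo).

(** Independence of the approximating sequences, a consequence of
    [kernel_form_null]. All the properties of the inner product are limits of
    those of the form on combinations. *)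
Lemma rkhs_dot_limit S T f g : kernel_limit k S f -> kernel_limit k T g ->
  (fun n => kernel_form k (S n) (T n) : C^o) @ \oo --> (rkhs_dot f g : C^o).
Proof.
have null S1 S2 T1 (h : rkhs k) : kernel_limit k S1 h -> kernel_limit k S2 h ->
    kernel_cauchy k T1 ->
    (fun n => kernel_form k (S1 n) (T1 n) - kernel_form k (S2 n) (T1 n) : C^o) @ \oo
      --> (0 : C^o).
  move=> l1 l2 cT; have [c0 h0] := kernel_limit_lin (-1) l2 l1.
  have -> : (fun n => kernel_form k (S1 n) (T1 n) - kernel_form k (S2 n) (T1 n) : C^o)
     = fun n => kernel_form k (scale_comb (-1) (S2 n) ++ S1 n) (T1 n).
    apply/funext => n; rewrite kernel_form_cat kernel_form_scale mulN1r addrC.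
    by [].
  apply: (kernel_form_null c0 cT) => y.
  by have := h0 y; rewrite scaleN1r addNr.
move=> Sf Tg; have [cf hf] := rkhs_approxP f; have [cg hg] := rkhs_approxP g.
have [cS _] := Sf; have [cT _] := Tg.
have lim0 := kernel_form_cvg cf cg.
have d1 := null _ _ _ _ Sf (rkhs_approxP f) cT.
have d2 := cvg_conj (null _ _ _ _ Tg (rkhs_approxP g) cf).
rewrite -[rkhs_dot f g]add0r -[0 in X in _ --> X](add0r 0) -[X in _ + X + _](rmorph0 Num.conj).
apply: cvg_eq_seq (cvgD (cvgD d1 d2) lim0) => n /=.
rewrite !fctE.
by rewrite rmorphB /= -!kernel_formC; ring.
Qed.

Lemma rkhs_dotC f g : rkhs_dot f g = (rkhs_dot g f)^*%R.
Proof.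
have h1 := rkhs_dot_limit (rkhs_approxP f) (rkhs_approxP g).
have h2 := cvg_conj (rkhs_dot_limit (rkhs_approxP g) (rkhs_approxP f)).
have E : (fun n => (kernel_form k (rkhs_approx g n) (rkhs_approx f n))^*%R : C^o)
    = fun n => kernel_form k (rkhs_approx f n) (rkhs_approx g n).
  by apply/funext => n; rewrite -kernel_formC.
by rewrite E in h2; exact: norm_cvg_unique h1 h2.
Qed.

Lemma rkhs_dot_lin a f g (h : rkhs k) :
  rkhs_dot (a *: f + g) h = a * rkhs_dot f h + rkhs_dot g h.
Proof.
have [af ag ah] := And3 (rkhs_approxP f) (rkhs_approxP g) (rkhs_approxP h).
have h1 := rkhs_dot_limit (f := a *: f + g) (kernel_limit_lin a af ag) ah.
have h2 : (fun n => a * kernel_form k (rkhs_approx f n) (rkhs_approx h n) : C^o) @ \oo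
    --> (a * rkhs_dot f h : C^o).
  by exact: (cvgM (cvg_cst (a : C^o)) (rkhs_dot_limit af ah)).
suff h4 : (fun n => kernel_form k (scale_comb a (rkhs_approx f n) ++ rkhs_approx g n)
    (rkhs_approx h n) : C^o) @ \oo --> (a * rkhs_dot f h + rkhs_dot g h : C^o).
  exact: norm_cvg_unique h1 h4.
apply: cvg_eq_seq (cvgD h2 (rkhs_dot_limit ag ah)) => n.
by rewrite fctE kernel_form_cat kernel_form_scale.
Qed.

Lemma rkhs_dot_ge0 f : 0 <= rkhs_dot f f.
Proof.
apply: (complex_cvg_ge0 (rkhs_dot_limit (rkhs_approxP f) (rkhs_approxP f))).
by apply: nearW => n; exact: kernel_form_ge0.
Qed.

Lemma kernel_comb_rkhs s : kernel_comb k s \in rkhs_pred k.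
Proof. by apply/rkhs_predP; exists (fun=> s); exact: kernel_limit_cst. Qed.

Definition rkhs_comb s : rkhs k := Rkhs (kernel_comb_rkhs s).

Lemma rkhs_dot_comb s t : rkhs_dot (rkhs_comb s) (rkhs_comb t) = kernel_form k s t.
Proof.
have := rkhs_dot_limit (f := rkhs_comb s) (g := rkhs_comb t)
  (kernel_limit_cst k s) (kernel_limit_cst k t) => h.
by apply: norm_cvg_unique h _; exact: cvg_cst.
Qed.

(** Evaluation at a point is an inner product; with the Cauchy-Schwarz
    inequality this makes the inner product definite. *)
Lemma rkhs_reproducing f y : rkhs_dot f (rkhs_comb [:: (1, y)]) = f y.
Proof.
have h := rkhs_dot_limit (g := rkhs_comb [:: (1, y)]) (rkhs_approxP f)
  (kernel_limit_cst k [:: (1, y)]).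
have [_ /(_ y) fy] := rkhs_approxP f; apply: norm_cvg_unique h _.
by rewrite (_ : (fun n => _) = fun n => kernel_comb k (rkhs_approx f n) y)//;
  apply/funext => n; rewrite kernel_form1.
Qed.

Lemma rkhs_dot_sqD f g a : rkhs_dot (f + a *: g) (f + a *: g) =
  rkhs_dot f f + a * rkhs_dot g f + (a * rkhs_dot g f)^*%R
    + a * a^*%R * rkhs_dot g g.
Proof.
rewrite (addrC f) rkhs_dot_lin (rkhs_dotC g (a *: g + f)) (rkhs_dotC f (a *: g + f)).
rewrite (rkhs_dot_lin a g f g) (rkhs_dot_lin a g f f).
move: (rkhs_dotC f f) (rkhs_dotC g g) (rkhs_dotC f g).
move: (rkhs_dot f f) (rkhs_dot g g) (rkhs_dot f g) (rkhs_dot g f) => ff gg fg gf.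
move=> ffE ggE fgE; rewrite !(rmorphD, rmorphM) /= -ffE -ggE fgE conjCK.
by ring.
Qed.

Lemma rkhs_CauchySchwarz f g : `|rkhs_dot f g| ^+ 2 <= rkhs_dot f f * rkhs_dot g g.
Proof.
rewrite mulrC; apply: discriminant_le; rewrite ?rkhs_dot_ge0// => a.
by rewrite -rkhs_dot_sqD rkhs_dot_ge0.
Qed.

Lemma rkhs_dot_eq0 f : rkhs_dot f f = 0 -> f = 0.
Proof.
move=> f0; apply: val_inj; apply/funext => y /=.
rewrite -rkhs_reproducing; apply/eqP; rewrite -normr_eq0 -sqrf_eq0 eq_le exprn_ge0//.
by rewrite andbT (le_trans (rkhs_CauchySchwarz _ _))// f0 mul0r.
Qed.

Definition rkhs_norm f : C := sqrtC (rkhs_dot f f).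

Lemma rkhs_normD f g : rkhs_norm (f + g) <= rkhs_norm f + rkhs_norm g.
Proof.
have := rkhs_dot_sqD f g 1; rewrite scale1r rmorph1 !mul1r => E.
apply: (sqrtC_triangle (d := rkhs_dot g f)); rewrite ?rkhs_dot_ge0//.
apply: le_sqrtCM (rkhs_dot_ge0 f) (rkhs_dot_ge0 g) _.
by rewrite mulrC; exact: rkhs_CauchySchwarz.
Qed.

Lemma rkhs_normZ a f : rkhs_norm (a *: f) = `|a| * rkhs_norm f.
Proof.
have dZ g : rkhs_dot (a *: f) g = a * rkhs_dot f g.
  have := rkhs_dot_lin a f 0 g; rewrite addr0 => ->.
  by have := rkhs_dot_lin (-1) g g g; rewrite scaleN1r addNr mulN1r addNr => ->; rewrite addr0.
rewrite /rkhs_norm dZ rkhs_dotC dZ rmorphM /= -rkhs_dotC mulrA -normCK.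
by rewrite sqrtCM ?nnegrE ?exprn_ge0 ?rkhs_dot_ge0// sqrCK.
Qed.

Lemma rkhs_norm_eq0 f : rkhs_norm f = 0 -> f = 0.
Proof. by move/eqP; rewrite sqrtC_eq0 => /eqP/rkhs_dot_eq0. Qed.

End rkhs_dot.

Section rkhs_hilbert.
Variables (R : realType) (X : Type) (k : posdef_kernel R X).
Local Notation C := R[i].
HB.instance Definition _ := Lmodule_isNormed.Build C (rkhs k)
  (@rkhs_normD R X k) (@rkhs_normZ R X k) (@rkhs_norm_eq0 R X k).

Lemma rkhs_normE (f : rkhs k) : `|f| = rkhs_norm f. Proof. by []. Qed.

Lemma rkhs_norm_comb s : `|rkhs_comb k s| = kernel_norm k s.
Proof. by rewrite rkhs_normE /rkhs_norm rkhs_dot_comb. Qed.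

Lemma rkhs_combB s t : rkhs_comb k (sub_comb s t) = rkhs_comb k s - rkhs_comb k t.
Proof. by apply: val_inj; rewrite /= kernel_combB. Qed.

Lemma cvg_rkhs_comb S (f : rkhs k) : kernel_limit k S f ->
  (fun n => rkhs_comb k (S n)) @ \oo --> f.
Proof.
move=> lS; have [cS _] := lS; apply/cvgrPdist_lt => e e0.
have [|N hN] := cS (e / 2); first by rewrite divr_gt0.
exists N => // n Nn.
apply: (@le_lt_trans _ _ (e / 2)); last by rewrite ltr_pdivrMr // ltr_pMr// ltr1n.
rewrite [f - _]addrC -scaleN1r rkhs_normE.
rewrite -ler_sqr ?nnegrE ?sqrtC_ge0 ?rkhs_dot_ge0 ?divr_ge0 ?(ltW e0)// sqrtCK.
have l := kernel_limit_lin (-1) (kernel_limit_cst k (S n)) lS.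
have := rkhs_dot_limit (f := (-1) *: rkhs_comb k (S n) + f)
  (g := (-1) *: rkhs_comb k (S n) + f) l l.
move=> /complex_cvg_le; apply; first exact: (cvg_cst ((e / 2) ^+ 2 : C^o)).
exists N => // m Nm /=; rewrite -[leLHS]sqrtCK ler_sqr ?nnegrE; last first.
- by rewrite divr_ge0 ?(ltW e0).
- exact: kernel_norm_ge0.
rewrite -/(kernel_norm k _) (kernel_norm_ext (s' := sub_comb (S m) (S n))) ?hN//.
by rewrite kernel_combB kernel_comb_cat kernel_comb_scale scaleN1r addrC.
Qed.

(** A Cauchy filter is followed by combinations [s n] at distance
    [n.+1%:R^-1]; they form a Cauchy sequence for the form, converge pointwise
    by completeness of the complex numbers, and their limit is an element of
    the space by definition. *)
Lemma rkhs_complete (F : set_system (rkhs k)) : ProperFilter F -> cauchy F -> cvg F.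
Proof.
move=> FF /cauchy_ballP cF.
have inv0 n : 0 < n.+1%:R^-1 :> C by rewrite invr_gt0 ltr0n.
have /choice[s hs] : forall n, exists s, F (ball (rkhs_comb k s) n.+1%:R^-1).
  move=> n; pose e : C := n.+1%:R^-1 / 2; have e0 : 0 < e by rewrite divr_gt0.
  have [[P Q] /= [FP FQ] PQ] := cF e e0.
  have [f Pf] := filter_ex FP.
  have /cvgrPdist_lt/(_ _ e0)[N _ /(_ N (leqnn N)) /= fS] :=
    cvg_rkhs_comb (rkhs_approxP f).
  exists (rkhs_approx f N); apply: filterS FQ => g Qg.
  have := PQ (f, g) (conj Pf Qg); rewrite -!ball_normE /= => fg.
  apply: le_lt_trans (ler_distD f _ _) _; rewrite [ltRHS]splitr.
  by apply: ltrD; [rewrite distrC; exact: fS | exact: fg].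
have cs : kernel_cauchy k s.
  move=> e e0; have [|N _ hN] := invSn_lt (e := e / 2); first by rewrite divr_gt0.
  exists N => m n /hN /= Nm /hN /= Nn.
  have [h [hm hn]] := filter_ex (filterI (hs m) (hs n)).
  rewrite -rkhs_norm_comb rkhs_combB; apply: le_trans (ler_distD h _ _) _.
  rewrite [leRHS]splitr; apply: lerD; apply: ltW; rewrite -ball_normE /= in hm hn.
    exact: lt_trans hm Nm.
  by rewrite distrC; exact: lt_trans hn Nn.
have /choice[f hf] : forall y, exists z, (fun n => kernel_comb k (s n) y) @ \oo --> (z : C^o).
  move=> y; exists (lim ((fun n => kernel_comb k (s n) y) @ \oo)).
  apply: complex_cauchy_cvg => e e0.
  have K1 : 0 < kernel_norm k [:: (1, y)] + 1 by rewrite ltr_wpDl ?kernel_norm_ge0.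
  have [|N hN] := cs (e / (kernel_norm k [:: (1, y)] + 1)); first by rewrite divr_gt0.
  exists N => m n Nm Nn.
  rewrite -!kernel_form1 -kernel_formBl (le_trans (kernel_CauchySchwarz _ _ _))//.
  rewrite -[leRHS](divfK (lt0r_neq0 K1)).
  by apply: ler_pM; rewrite ?kernel_norm_ge0 ?hN// lerDl.
have fP : f \in rkhs_pred k by apply/rkhs_predP; exists s.
have /cvgrPdist_lt sf := cvg_rkhs_comb (f := Rkhs fP) (conj cs hf).
apply/cvg_ex; exists (Rkhs fP); apply/cvgrPdist_lt => e e0.
have e2 : 0 < e / 2 by rewrite divr_gt0.
have [n [/= n1 n2]] := filter_ex (filterI (sf _ e2) (invSn_lt e2)).
apply: filterS (hs n) => h; rewrite -ball_normE /= => nh.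
apply: le_lt_trans (ler_distD (rkhs_comb k (s n)) _ _) _; rewrite [ltRHS]splitr.
by apply: ltrD; [exact: n1 | exact: lt_trans nh n2].
Qed.

HB.instance Definition _ := Uniform_isComplete.Build (rkhs k) rkhs_complete.

Lemma rkhs_dot_bilinear : bilinear_for
  ( *%R : GRing.Scale.law C C) (Num.conj \; *%R : GRing.Scale.law C C) (@rkhs_dot R X k).
Proof.
split=> [h a f g|h a f g] /=; first exact: rkhs_dot_lin.
rewrite (rkhs_dotC h (a *: f + g)) rkhs_dot_lin (rkhs_dotC h f) (rkhs_dotC h g).
by move: (rkhs_dot f h) (rkhs_dot g h) => u v; rewrite rmorphD rmorphM.
Qed.

HB.instance Definition _ := bilinear_isBilinear.Build C (rkhs k) (rkhs k) C _ _
  (@rkhs_dot R X k) rkhs_dot_bilinear.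

Lemma rkhs_dot_hermitian (f g : rkhs k) :
  rkhs_dot f g = (-1) ^+ false * (rkhs_dot g f)^*%R.
Proof. by rewrite mul1r -rkhs_dotC. Qed.

HB.instance Definition _ := isHermitianSesquilinear.Build C (rkhs k) false
  (@Num.conj C) (@rkhs_dot R X k) rkhs_dot_hermitian.

Lemma rkhs_dot_gt0 (f : rkhs k) : f != 0 -> 0 < rkhs_dot f f.
Proof.
move=> f0; rewrite lt0r rkhs_dot_ge0 andbT; apply: contra f0 => /eqP f0.
by rewrite (rkhs_dot_eq0 f0).
Qed.

HB.instance Definition _ := isDotProduct.Build C (rkhs k) (@rkhs_dot R X k) rkhs_dot_gt0.

Lemma rkhs_dot_norm (f : rkhs k) : rkhs_dot f f = `|f| ^+ 2.
Proof. by rewrite rkhs_normE sqrtCK. Qed.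

HB.instance Definition _ := CompleteNormedModule_isHilbert.Build R (rkhs k) rkhs_dot_norm.

End rkhs_hilbert.

(** The theorem of Moore and Aronszajn, or Kolmogorov decomposition of a
    positive definite kernel. The family is total because every function in
    the space is a limit of combinations by construction. *)
Theorem kernel_realization (R : realType) (X : Type) (k : posdef_kernel R X) :
  exists (E : hilbertType R) (i : X -> E),
    (forall x y, hdot (i x) (i y) = k x y) /\ closed_lin_span (range i) = setT.
Proof.
pose i (x : X) : rkhs k := rkhs_comb k [:: (1, x)].
exists (rkhs k : hilbertType R), i; split=> [x y|].
  rewrite [LHS]rkhs_reproducing /= kernel_combE big_seq1 mul1r.
  by [].
have combE s : rkhs_comb k s = lincomb i s.
  elim: s => [|p s IH]; apply: val_inj.
    by rewrite /= /kernel_comb /lincomb !big_nil.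
  rewrite /lincomb big_cons -/(lincomb i s) -IH /= /kernel_comb /lincomb.
  by rewrite !big_cons big_nil scale1r addr0.
apply/seteqP; split => // f _ B.
move=> /(cvg_rkhs_comb (rkhs_approxP f))[N _ /(_ N (leqnn N)) BN].
exists (rkhs_comb k (rkhs_approx f N)); split => //.
by apply/lin_span_lincomb; exists (rkhs_approx f N).
Qed.

(** * Total families with given Gram kernel *)

Section total.
Variables (R : realType) (X : Type).
Local Notation C := R[i].
Implicit Types E H K : hilbertType R.

Lemma bounded_id_bounded H : bounded_near (idfun : H -> H) (nbhs (0 : H)).
Proof. by apply/bounded_funP => r; exists r. Qed.

Definition bounded_id H : bounded_op H H := BoundedOp (@bounded_id_bounded H).

Lemma bounded_comp_bounded E H K (A : bounded_op H K) (B : bounded_op E H) :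
  bounded_near (A \o B) (nbhs (0 : E)).
Proof.
apply/bounded_funP => r.
have /bounded_funP/(_ r)[M hM] := bounded_op_bounded B.
have /bounded_funP/(_ M)[N hN] := bounded_op_bounded A.
by exists N => x /hM/hN.
Qed.

Definition bounded_comp E H K (A : bounded_op H K) (B : bounded_op E H) :
  bounded_op E K := BoundedOp (bounded_comp_bounded A B).

Lemma total_hdot_injr E (i : X -> E) (a b : E) : closed_lin_span (range i) = setT ->
  (forall x, hdot (i x) a = hdot (i x) b) -> a = b.
Proof.
move=> itot ab; apply/eqP; rewrite -subr_eq0 -normr_eq0 -sqrf_eq0 -hdot_norm.
have : closed_lin_span (range i) (a - b) by rewrite itot.
move=> /closure_seq[u [us /cvg_hdot/(_ (cvg_cst (a - b)))]] h.
have E0 : (fun n => hdot (u n) (a - b) : C^o) = cst 0.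
  apply/funext => n /=; have /lin_span_lincomb[s ->] := us n.
  rewrite linear_sumlz big1// => p _.
  by rewrite linearZl_LR linearB /= ab subrr mulr0.
apply/eqP; rewrite E0 in h; apply: norm_cvg_unique h _; exact: cvg_cst.
Qed.

Lemma total_adjoint_eq E (i : X -> E) (A B : bounded_op E E) :
  closed_lin_span (range i) = setT ->
  (forall x y, hdot (A (i x)) (i y) = hdot (i x) (B (i y))) -> adjoint A = B.
Proof.
move=> itot AB; apply: bounded_op_eq; apply: (eq_total itot) => _ [y _ <-].
by apply: (total_hdot_injr itot) => x; rewrite -adjointP AB.
Qed.

Lemma hdot_lincomb E (i : X -> E) s : hdot (lincomb i s) (lincomb i s) =
  \sum_(p <- s) \sum_(q <- s) p.1 * q.1^*%R * hdot (i p.2) (i q.2).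
Proof.
rewrite linear_sumlz; apply: eq_bigr => p _; rewrite linear_sumr.
by apply: eq_bigr => q _; rewrite linearZl_LR linearZr_LR /= mulrA.
Qed.

Lemma gram_extension E K (i : X -> E) (t : X -> K) (M : C) : 0 <= M ->
  closed_lin_span (range i) = setT ->
  (forall s, hdot (lincomb t s) (lincomb t s) <=
     M * hdot (lincomb i s) (lincomb i s)) ->
  exists T : bounded_op E K, forall x, T (i x) = t x.
Proof.
move=> M0 itot h; apply: (bounded_extension (M := sqrtC M)) => //.
  by rewrite sqrtC_ge0.
move=> s; rewrite -ler_sqr ?nnegrE ?mulr_ge0 ?sqrtC_ge0// exprMn sqrtCK.
by rewrite -[leLHS]hdot_norm -[X in _ * X]hdot_norm.
Qed.

Lemma gram_isometry E K (i : X -> E) (t : X -> K) :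
  closed_lin_span (range i) = setT ->
  (forall x y, hdot (t x) (t y) = hdot (i x) (i y)) ->
  exists T : bounded_op E K, forall x, T (i x) = t x.
Proof.
move=> itot ti; apply: (gram_extension (M := 1)) => // s.
rewrite mul1r !hdot_lincomb le_eqVlt; apply/orP; left; apply/eqP.
by apply: eq_bigr => p _; apply: eq_bigr => q _; rewrite ti.
Qed.

(** The isometries from each family to the other are mutually inverse on the
    families, hence everywhere, and the inverse of an isometry is its
    adjoint. *)
Lemma gram_unitary E K (i : X -> E) (t : X -> K) :
  closed_lin_span (range i) = setT -> closed_lin_span (range t) = setT ->
  (forall x y, hdot (t x) (t y) = hdot (i x) (i y)) ->
  exists U : bounded_op E K, unitary U /\ forall x, U (i x) = t x.
Proof.
move=> itot ttot ti; have [U Ui] := gram_isometry itot ti.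
have [W Wt] := gram_isometry ttot (fun x y => esym (ti x y)).
have WU : bounded_comp W U =1 bounded_id E.
  by apply: (eq_total itot) => _ [x _ <-] /=; rewrite Ui Wt.
have UW : bounded_comp U W =1 bounded_id K.
  by apply: (eq_total ttot) => _ [x _ <-] /=; rewrite Wt Ui.
suff aU : adjoint U = W by exists U; split => //; split; rewrite aU.
apply: bounded_op_eq; apply: (eq_total ttot) => _ [y _ <-].
by apply: (total_hdot_injr itot) => x; rewrite -adjointP Ui Wt ti.
Qed.
End total.

(** * Dilations of alpha-completely positive maps *)

Section dilation.
Variables (R : realType) (G : groupType) (alpha : G -> G) (H : hilbertType R).
Local Notation C := R[i].
Implicit Types (phi : G -> bounded_op H H) (s : seq (C * (G * H))).

Definition alpha_invariant phi : Prop := forall g1 g2,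
  phi (alpha g1 * alpha g2)%g = phi (alpha (g1 * g2)%g) /\
  phi (alpha (g1 * g2)%g) = phi (g1 * g2)%g.

(** The only possible Gram kernel of the family [pi g (V xi)] of a dilation,
    see [krein_dilation_gram]. *)
Definition alpha_kernel phi (x y : G * H) : C :=
  hdot (phi ((alpha y.1)^-1 * x.1)%g x.2) y.2.

(** Positivity of operator matrices is positivity of scalar kernels on
    [G * H]: the coefficients of a combination are absorbed in the vectors. *)
Lemma opmx_formE (F : G -> G -> bounded_op H H) s
    (g := fun j => (tnth (in_tuple s) j).2.1)
    (x := fun j => (tnth (in_tuple s) j).1 *: (tnth (in_tuple s) j).2.2) :
  \sum_i hdot (opmx_apply (\matrix_(i, j) (F (g i) (g j) : H -> H)) x i) (x i) =
  \sum_(p <- s) \sum_(q <- s) p.1 * q.1^*%R * hdot (F q.2.1 p.2.1 p.2.2) q.2.2.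
Proof.
rewrite exchange_big big_tnth /=; apply: eq_bigr => i _.
rewrite big_tnth /opmx_apply linear_sumlz; apply: eq_bigr => j _.
by rewrite mxE /x [F _ _ _]linearZ /= linearZl_LR linearZr_LR /= mulrA.
Qed.

Lemma opmx_leE n (A B : 'M[H -> H]_n) (a : R) (x : 'I_n -> H) :
  opmx_le A (opmx_scale a B) ->
  \sum_i hdot (opmx_apply A x i) (x i) <=
  a%:C * \sum_i hdot (opmx_apply B x i) (x i).
Proof.
have applyE i : opmx_apply (opmx_scale a B - A) x i =
    a%:C *: opmx_apply B x i - opmx_apply A x i.
  rewrite /opmx_apply scaler_sumr -sumrB; apply: eq_bigr => j _.
  by rewrite !mxE.
move=> /(_ x) h; rewrite -subr_ge0; move: h; congr (0 <= _).
rewrite mulr_sumr -sumrB; apply: eq_bigr => i _.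
by rewrite applyE linearBl linearZl_LR.
Qed.

Lemma alpha_kernel_pos phi :
  (forall n (g : 'I_n -> G), opmx_pos (alpha_gram alpha phi g)) ->
  forall s, 0 <= \sum_(p <- s) \sum_(q <- s) p.1 * q.1^*%R * alpha_kernel phi p.2 q.2.
Proof.
move=> pos s; rewrite /alpha_kernel.
rewrite -(opmx_formE (fun g h => phi ((alpha g)^-1 * h)%g)).
exact: pos.
Qed.

(** This identity makes [alpha] act isometrically for the kernel, hence gives
    the fundamental symmetry. *)
Lemma phi_alphaV phi : group_involution alpha ->
  alpha_invariant phi ->
  forall g h, phi (h^-1 * alpha g)%g = phi ((alpha h)^-1 * g)%g.
Proof.
move=> [aK a1 aV] c1 g h; have [e1 e2] := c1 (alpha h)^-1%g g.
by rewrite -[RHS]e2 -e1 aV aK.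
Qed.

(** The adjoint of [pi h] is [J pi(h^-1) J], and every [J] can be pushed
    towards [V], where it becomes [alpha]; what remains is
    [V^* pi(alpha (h^-1 alpha g)) V]. *)
Lemma krein_dilation_gram phi K (J : bounded_op K K) pi (V : bounded_op H K) :
  group_involution alpha ->
  alpha_invariant phi ->
  krein_dilation alpha phi J pi V ->
  forall x y : G * H,
    hdot (pi x.1 (V x.2)) (pi y.1 (V y.2)) = alpha_kernel phi x y.
Proof.
move=> ainv c1 [[_ JJ] [piM pi1 piV] phiE _ Jpi] [g xi] [h eta] /=.
have adj z : adjoint (pi h) z = J (pi h^-1%g (J z)).
  by rewrite [pi h^-1%g _]piV /= [J (J z)]JJ [J (J _)]JJ.
rewrite hdotC adjointP -hdotC adj [J (pi g _)]Jpi /= -[pi _ (pi _ _)]piM.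
rewrite [J (pi _ _)]Jpi hdotC adjointP -hdotC /=.
rewrite -[adjoint V _]/((adjoint V \o pi _ \o V) xi) -phiE /alpha_kernel /=.
by have [_ e2] := c1 1%g (h^-1 * alpha g)%g; rewrite mul1g in e2; rewrite e2 phi_alphaV.
Qed.

Lemma krein_dilation_total phi K (J : bounded_op K K) pi (V : bounded_op H K) :
  krein_dilation alpha phi J pi V ->
  closed_lin_span (range (fun x : G * H => pi x.1 (V x.2))) = setT.
Proof.
move=> [_ _ _ <- _]; congr closed_lin_span; apply/seteqP; split => x /=.
  by move=> [[g xi] _ <-]; exists g, xi.
by move=> [g [xi ->]]; exists (g, xi).
Qed.

Lemma krein_dilation_unique phi Hphi (Jphi : bounded_op Hphi Hphi) piphi
    (Vphi : bounded_op H Hphi) K (J : bounded_op K K) pi (V : bounded_op H K) :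
  group_involution alpha ->
  alpha_invariant phi ->
  krein_dilation alpha phi Jphi piphi Vphi -> krein_dilation alpha phi J pi V ->
  exists U : bounded_op Hphi K,
     [/\ unitary U, U \o Jphi =1 J \o U, U \o Vphi =1 V
       & forall g, U \o piphi g =1 pi g \o U].
Proof.
move=> ainv c1 d1 d2.
have t1 := krein_dilation_total d1; have t2 := krein_dilation_total d2.
have [x y|U [Uu Ui]] := gram_unitary t1 t2.
  by rewrite (krein_dilation_gram ainv c1 d1) (krein_dilation_gram ainv c1 d2).
have [[_ _] [M1 I1 _] _ _ J1] := d1; have [[_ _] [M2 I2 _] _ _ J2] := d2.
exists U; split => //.
- change (bounded_comp U Jphi =1 bounded_comp J U).
  apply: (eq_total t1) => _ [[g xi] _ <-] /=.
  rewrite [Jphi _]J1 /= (Ui (g, xi)) /= [J _]J2.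
  exact: (Ui (alpha g, xi)).
- move=> xi; have /= := Ui (1%g, xi).
  by rewrite [piphi _ _]I1 [pi _ _]I2.
- move=> g; change (bounded_comp U (piphi g) =1 bounded_comp (pi g) U).
  apply: (eq_total t1) => _ [[h xi] _ <-] /=.
  rewrite -[piphi _ (piphi _ _)]M1 (Ui (h, xi)) /= -[pi _ (pi _ _)]M2.
  exact: (Ui ((g * h)%g, xi)).
Qed.

Lemma krein_dilation_exists phi : group_involution alpha ->
  alpha_completely_positive alpha phi ->
  exists (Hphi : hilbertType R) (Jphi : bounded_op Hphi Hphi)
     (piphi : G -> bounded_op Hphi Hphi) (Vphi : bounded_op H Hphi),
     krein_dilation alpha phi Jphi piphi Vphi.
Proof.
move=> ainv [c1 c2 _ c4]; have [aK a1 aV] := ainv.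
have [E [i [iE itot]]] := kernel_realization (PosDefKernel (alpha_kernel_pos c2)).
rewrite /= in iE.
have [x y|J Ji] := gram_isometry (t := fun x : G * H => i (alpha x.1, x.2)) itot.
  by rewrite !iE /alpha_kernel /= aK phi_alphaV.
(* The fourth condition is the bound that [gram_extension] asks for the left
   translate by [g] of the family. *)
have /choice[pi piE] : forall g, exists P : bounded_op E E,
    forall x : G * H, P (i x) = i (g * x.1, x.2)%g.
  move=> g; have [M [M0 hM]] := c4 g.
  have M0' : 0 <= M%:C by rewrite lecR ltW.
  apply: (gram_extension M0' itot) => s; rewrite !hdot_lincomb.
  have h := opmx_leE _ (hM _ (fun j => (tnth (in_tuple s) j).2.1)).
  have := h (fun j => (tnth (in_tuple s) j).1 *: (tnth (in_tuple s) j).2.2).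
  rewrite (opmx_formE (fun h l => phi ((alpha (g * h))^-1 * (g * l))%g)).
  rewrite (opmx_formE (fun h l => phi ((alpha h)^-1 * l)%g)) {h}.
  congr (_ <= _ * _); apply: eq_bigr => p _; apply: eq_bigr => q _;
    by rewrite iE.
(* The kernel is linear in the vector, and the family [i] is total. *)
have ilin g : linear (fun xi : H => i (g, xi)).
  move=> a xi eta; apply: (total_hdot_injr itot) => x.
  rewrite linearD /= linearZr_LR /= !iE /alpha_kernel /=.
  by rewrite linearD /= linearZr_LR.
have [M M0 phi1] := bounded_opP (phi 1%g).
have ibound xi : `|i (1%g, xi)| <= sqrtC M * `|xi|.
  rewrite -ler_sqr ?nnegrE ?mulr_ge0 ?sqrtC_ge0 ?(ltW M0)// exprMn sqrtCK.
  rewrite -[leLHS]hdot_norm iE /alpha_kernel /= a1 invg1 mulg1.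
  have := hdot_CauchySchwarz (phi 1%g xi) xi; rewrite ger0_norm; last first.
    have := hdot_ge0 (i (1%g, xi)); rewrite iE /alpha_kernel /= a1 invg1 mulg1.
    by [].
  move=> /le_trans; apply; rewrite expr2 mulrA ler_wpM2r//.
have [V VE] := bounded_op_exists (ilin 1%g) (etrans (sqrtC_ge0 M) (ltW M0)) ibound.
have piV g xi : pi g (V xi) = i (g, xi) by rewrite VE piE mulg1.
have JJ : bounded_comp J J =1 bounded_id E.
  by apply: (eq_total itot) => _ [[g xi] _ <-] /=; rewrite !Ji /= aK.
have adjpi g : adjoint (pi g) = bounded_comp J (bounded_comp (pi g^-1%g) J).
  apply: (total_adjoint_eq itot) => x y /=.
  by rewrite Ji !piE Ji !iE /alpha_kernel /= aK invgM invgK mulgA.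
exists E, J, pi, V; split.
- split=> //; apply: (total_adjoint_eq itot) => x y.
  by rewrite !Ji !iE /alpha_kernel /= phi_alphaV.
- split.
  + move=> g h; change (pi (g * h)%g =1 bounded_comp (pi g) (pi h)).
    by apply: (eq_total itot) => _ [x _ <-] /=; rewrite !piE mulgA.
  + change (pi 1%g =1 bounded_id E).
    by apply: (eq_total itot) => _ [x _ <-] /=; rewrite piE mul1g; case: x.
  + by move=> g x; rewrite adjpi /= [J (J x)]JJ [J (J _)]JJ.
- move=> g xi; apply: hdot_injr => eta /=.
  rewrite -adjointP piV VE [RHS]hdotC iE /alpha_kernel /= a1 invg1 mul1g.
  by rewrite -hdotC.
- rewrite -[RHS]itot; congr closed_lin_span; apply/seteqP; split => x /=.
    by move=> [g [xi ->]]; exists (g, xi).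
  by move=> [[g xi] _ <-]; exists g, xi; rewrite piV.
- by move=> g xi /=; rewrite !piV Ji.
Qed.
End dilation.

Theorem theorem2p8 (R : realType) (G : groupType) (alpha : G -> G)
    (H : hilbertType R) (phi : G -> bounded_op H H)
    (alpha_invol : group_involution alpha)
    (phi_cp : alpha_completely_positive alpha phi) :
  (exists (Hphi : hilbertType R) (Jphi : bounded_op Hphi Hphi)
     (piphi : G -> bounded_op Hphi Hphi) (Vphi : bounded_op H Hphi),
     krein_dilation alpha phi Jphi piphi Vphi)
  /\
  (forall (Hphi : hilbertType R) (Jphi : bounded_op Hphi Hphi)
     (piphi : G -> bounded_op Hphi Hphi) (Vphi : bounded_op H Hphi),
     krein_dilation alpha phi Jphi piphi Vphi ->
   forall (K : hilbertType R) (J : bounded_op K K)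
     (pi : G -> bounded_op K K) (V : bounded_op H K),
     krein_dilation alpha phi J pi V ->
   exists U : bounded_op Hphi K,
     [/\ unitary U,
         U \o Jphi =1 J \o U,
         U \o Vphi =1 V
       & forall g, U \o piphi g =1 pi g \o U]).
Proof.
split; first exact: krein_dilation_exists.
move=> Hphi Jphi piphi Vphi d1 K J pi V d2.
by have [c1 _ _ _] := phi_cp; exact: krein_dilation_unique d1 d2.
Qed.
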